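(* Let $n\ge1$. There exists an element $\Lambda\in\mathcal{UD}$ such that $\delta(\mathcal{B}(\Lambda))=\delta_n$.
   Context: $B(c,t)$ is the closed ball of $\mathbb{R}^n$ with center $c$ and radius $t$, and $B=B(0,1/2)$. $\mathcal{UD}$ is the set of all uniformly discrete subsets of $\mathbb{R}^n$ of constant $1$, i.e. subsets $\Lambda$ with $\|x-y\|\ge 1$ for all distinct $x,y\in\Lambda$ (the empty set and finite sets are included). For $\Lambda\in\mathcal{UD}$, $\mathcal{B}(\Lambda)=\{\lambda+B:\lambda\in\Lambda\}$ is the associated packing of balls of radius $1/2$, with density $$\delta(\mathcal{B}(\Lambda))=\limsup_{T\to+\infty}\frac{\mathrm{vol}\big((\bigcup_{\lambda\in\Lambda}(\lambda+B))\cap B(0,T)\big)}{\mathrm{vol}(B(0,T))}.$$ The packing constant is $\delta_n=\sup_{\Lambda\in\mathcal{UD}}\delta(\mathcal{B}(\Lambda))$, the supremum of the densities of all packings of equal balls of $\mathbb{R}^n$. *)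

(* Defs.v *)
From HB Require Import structures.
From mathcomp Require Import all_boot all_order all_algebra.
From mathcomp Require Import all_classical all_reals all_analysis.

Set Implicit Arguments.
Unset Strict Implicit.
Unset Printing Implicit Defensive.

Import Order.TTheory GRing.Theory Num.Theory.
Import numFieldNormedType.Exports.

Local Open Scope classical_set_scope.
Local Open Scope ring_scope.

(* Lebesgue measure on n.-tuple R: the n-fold product of the one-dimensional
   Lebesgue measure, transported along (x, t) |-> x :: t at each step. *)

Definition tuple_cons (R : realType) (n : nat)
    (p : measurableTypeR R * n.-tuple (measurableTypeR R)) :
  n.+1.-tuple (measurableTypeR R) := [tuple of p.1 :: p.2].

Lemma measurable_tuple_cons (R : realType) (n : nat) :
  measurable_fun setT (@tuple_cons R n).
Proof. exact: measurable_cons. Qed.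

HB.instance Definition _ (R : realType) (n : nat) :=
  isMeasurableFun.Build _ _ _ _ (@tuple_cons R n) (@measurable_tuple_cons R n).

Section lebesgue_tuple_step.
Local Open Scope ereal_scope.
Context {R : realType} {n : nat}.
Variable mu : {sigma_finite_measure set (n.-tuple (measurableTypeR R)) -> \bar R}.

Definition lebesgue_tuple_step :
    set (n.+1.-tuple (measurableTypeR R)) -> \bar R :=
  pushforward (@lebesgue_measure R \x mu) (@tuple_cons R n).

Let step0 : lebesgue_tuple_step set0 = 0.
Proof. exact: measure0. Qed.

Let step_ge0 A : 0 <= lebesgue_tuple_step A.
Proof. exact: measure_ge0. Qed.

Let step_sigma_additive : semi_sigma_additive lebesgue_tuple_step.
Proof. exact: measure_semi_sigma_additive. Qed.

HB.instance Definition _ := isMeasure.Build _ _ _ lebesgue_tuple_step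
  step0 step_ge0 step_sigma_additive.

Let step_sigma_finite : sigma_finite setT lebesgue_tuple_step.
Proof.
have /sigma_finiteP[F [TF ndF Foo]] := sigma_finiteT (@lebesgue_measure R).
have /sigma_finiteP[G [TG ndG Goo]] := sigma_finiteT mu.
pose h (t : n.+1.-tuple (measurableTypeR R)) := thead t.
pose b (t : n.+1.-tuple (measurableTypeR R)) : n.-tuple (measurableTypeR R) :=
  [tuple of behead t].
have mh : measurable_fun setT h by exact: measurable_tnth.
have mb : measurable_fun setT b by exact: measurable_behead.
exists (fun k => h @^-1` F k `&` b @^-1` G k).
  apply/esym; rewrite -subTset => t _.
  have [i _ Fi] : (\bigcup_i F i) (h t) by rewrite -TF.
  have [j _ Gj] : (\bigcup_i G i) (b t) by rewrite -TG.
  exists (maxn i j) => //; split => /=.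
  - by move: (h t) Fi; exact/subsetPset/ndF/leq_maxl.
  - by move: (b t) Gj; exact/subsetPset/ndG/leq_maxr.
move=> k; have [mF Fk] := Foo k; have [mG Gk] := Goo k; split.
  apply: measurableI; rewrite -[X in measurable X]setTI; [exact: mh|exact: mb].
rewrite /lebesgue_tuple_step /pushforward.
rewrite [X in (_ \x _) X](_ : _ = F k `*` G k); last first.
  apply/funext => -[x t]; rewrite /preimage /setI /setX /=.
  rewrite (_ : h _ = x)//.
  by rewrite (_ : b _ = t)//; exact: val_inj.
by rewrite product_measure1E// lte_mul_pinfty// ge0_fin_numE.
Qed.

HB.instance Definition _ := Measure_isSigmaFinite.Build _ _ _
  lebesgue_tuple_step step_sigma_finite.

End lebesgue_tuple_step.

Fixpoint lebesgue_tuple (R : realType) (n : nat) :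
    {sigma_finite_measure set (n.-tuple (measurableTypeR R)) -> \bar R} :=
  match n with
  | 0 => @dirac _ _ [tuple] R
  | n'.+1 => lebesgue_tuple_step (lebesgue_tuple R n')
  end.

Section packings.
Context {R : realType} {n : nat}.

(* The ambient sigma-algebra is the Borel one; balls and unions of packings of
   balls of radius 1/2 are closed, so vol is only applied to Borel sets. *)
Definition vol (A : set 'rV[R]_n) : \bar R :=
  lebesgue_tuple R n [set t | A (\row_i tnth t i)].

(* The norm `|x| of the library on 'rV[R]_n is the sup norm, so the Euclidean
   norm and its closed balls are defined separately. *)
Definition norm2 (x : 'rV[R]_n) : R := Num.sqrt (\sum_(i < n) x 0 i ^+ 2).

Definition cball (c : 'rV[R]_n) (t : R) : set 'rV[R]_n :=
  [set x | norm2 (x - c) <= t].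

Definition UD : set (set 'rV[R]_n) :=
  [set L | forall x y, L x -> L y -> x <> y -> 1 <= norm2 (x - y)].

Definition translate (x : 'rV[R]_n) (A : set 'rV[R]_n) : set 'rV[R]_n :=
  [set x + a | a in A].

Definition packing (L : set 'rV[R]_n) : set (set 'rV[R]_n) :=
  [set translate l (cball 0 2^-1) | l in L].

Definition density (P : set (set 'rV[R]_n)) : \bar R :=
  limf_esup
    (fun T : R => vol ((\bigcup_(S in P) S) `&` cball 0 T) / vol (cball 0 T))%E
    (pinfty_nbhs R).

End packings.

Definition packing_constant (R : realType) (n : nat) : \bar R :=
  ereal_sup [set density (packing L) | L in @UD R n].

(* Main.v *)
(* Choose L_k in UD and radii T_k such that, up to the ball of radius T_k, the
   density of the packing of L_k exceeds the packing constant minus 1/(k+1), with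
   T_k so large that the ball reaching slightly beyond T_(k-1) has negligible
   volume in it. The set of the points of L_k lying in the k-th annulus
   T_(k-1) + 3/2 <= |x| <= T_k + 1/2, for all k, is in UD because distinct annuli
   are at distance at least 1. Up to radius T_k its density is almost that of
   L_k, and since the density is a limsup, the radii T_k suffice. *)
Require Import Defs.
From mathcomp Require Import all_boot all_order all_algebra.
From mathcomp Require Import all_classical all_reals all_analysis.
From mathcomp Require Import measurable_realfun ring lra.

Set Implicit Arguments.
Unset Strict Implicit.
Unset Printing Implicit Defensive.

Import Order.TTheory GRing.Theory Num.Theory.
Import numFieldNormedType.Exports.

Local Open Scope classical_set_scope.
Local Open Scope ring_scope.

(** * The Euclidean norm: Cauchy-Schwarz, triangle inequality, comparison with coordinates *)

Section euclidean_norm.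
Context {R : realType} {n : nat}.
Implicit Types x y z : 'rV[R]_n.

Lemma norm2_ge0 x : 0 <= norm2 x.
Proof. exact: sqrtr_ge0. Qed.

Lemma sqr_norm2 x : norm2 x ^+ 2 = \sum_(i < n) x 0 i ^+ 2.
Proof. by rewrite sqr_sqrtr// sumr_ge0// => i _; exact: sqr_ge0. Qed.

Lemma norm2_le x r : 0 <= r -> (norm2 x <= r) = (norm2 x ^+ 2 <= r ^+ 2).
Proof. by move=> r0; rewrite ler_sqr ?nnegrE ?norm2_ge0. Qed.

Lemma norm2N x : norm2 (- x) = norm2 x.
Proof. by congr Num.sqrt; apply: eq_bigr => i _; rewrite mxE sqrrN. Qed.

Lemma coord_le_norm2 x i : `|x 0 i| <= norm2 x.
Proof.
rewrite -[leLHS]sqrtr_sqr ler_wsqrtr// (bigD1 i)//= lerDl.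
by rewrite sumr_ge0// => j _; exact: sqr_ge0.
Qed.

Lemma norm2_eq0 x : norm2 x = 0 -> x = 0.
Proof.
move=> x0; apply/rowP => i; apply/eqP.
by rewrite mxE -normr_le0 -x0 coord_le_norm2.
Qed.

(** With [a = norm2 x], [b = norm2 y] and [s] the inner product, the nonnegative sum of the squares
    of [b * x_i - a * y_i] equals [2ab(ab - s)]. The cases [a = 0] and [b = 0] are treated first, so
    that [ab > 0] can be cancelled. *)
Lemma Cauchy_Schwarz_norm2 x y :
  \sum_(i < n) x 0 i * y 0 i <= norm2 x * norm2 y.
Proof.
have := norm2_ge0 x; rewrite le_eqVlt => /predU1P[/esym x0|x0].
  rewrite x0 mul0r (norm2_eq0 x0) big1// => i _.
  by rewrite mxE mul0r.
have := norm2_ge0 y; rewrite le_eqVlt => /predU1P[/esym y0|y0].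
  rewrite y0 mulr0 (norm2_eq0 y0) big1// => i _.
  by rewrite mxE mulr0.
set a := norm2 x; set b := norm2 y; set s := \sum_(i < n) _.
have : 0 <= \sum_(i < n) (b * x 0 i - a * y 0 i) ^+ 2.
  by rewrite sumr_ge0// => i _; exact: sqr_ge0.
have -> : \sum_(i < n) (b * x 0 i - a * y 0 i) ^+ 2 =
    (a * b) * ((a * b - s) *+ 2).
  transitivity (b ^+ 2 * (\sum_(i < n) x 0 i ^+ 2)
      + a ^+ 2 * (\sum_(i < n) y 0 i ^+ 2) - a * b * s *+ 2).
    rewrite /s !mulr_sumr -sumrMnl -sumrN -!big_split/=.
    by apply: eq_bigr => i _; ring.
  rewrite -!sqr_norm2 -/a -/b.
  ring.
by rewrite pmulr_rge0 ?mulr_gt0// -mulr_natl pmulr_rge0// subr_ge0.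
Qed.

Lemma ler_norm2D x y : norm2 (x + y) <= norm2 x + norm2 y.
Proof.
rewrite norm2_le ?addr_ge0 ?norm2_ge0// sqrrD !sqr_norm2.
have -> : \sum_(i < n) (x + y) 0 i ^+ 2 = \sum_(i < n) x 0 i ^+ 2 +
    (\sum_(i < n) x 0 i * y 0 i) *+ 2 + \sum_(i < n) y 0 i ^+ 2.
  rewrite -sumrMnl -!big_split/=; apply: eq_bigr => i _.
  by rewrite mxE sqrrD.
by rewrite lerD2r lerD2l lerMn2r/= Cauchy_Schwarz_norm2.
Qed.

Lemma ler_norm2B x y : norm2 x - norm2 y <= norm2 (x - y).
Proof. by rewrite lerBlDr -{1}(subrK y x) ler_norm2D. Qed.

Lemma norm2_distC x y : norm2 (x - y) = norm2 (y - x).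
Proof. by rewrite -norm2N opprB. Qed.

(** The factor [n] is cruder than the square root of [n], but it avoids a radical and is enough to
    put a cube inside a ball. *)
Lemma norm2_le_coord x a : 0 <= a ->
  (forall i, `|x 0 i| <= a) -> norm2 x <= n%:R * a.
Proof.
move=> a0 xa; rewrite norm2_le ?mulr_ge0// sqr_norm2.
apply: (@le_trans _ _ (\sum_(i < n) a ^+ 2)).
  apply: ler_sum => i _.
  by rewrite -[leLHS]real_normK ?num_real// ler_sqr ?nnegrE.
rewrite sumr_const card_ord -[leLHS]mulr_natl exprMn ler_wpM2r ?sqr_ge0//.
by rewrite -natrX ler_nat; case: n => // m; rewrite -mulnn leq_pmull.
Qed.

End euclidean_norm.

(** * Measurability of sets of row vectors and monotonicity of volume *)

Section vol.
Context {R : realType} {n : nat}.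
Implicit Types (A B : set 'rV[R]_n) (c x y : 'rV[R]_n).

Definition tuple_preimage A : set (n.-tuple (measurableTypeR R)) :=
  [set t | A (\row_i tnth t i)].

(** [vol] is computed on tuples, so measurability of a set of rows is read off its preimage
    there. *)
Definition row_measurable A := measurable (tuple_preimage A).

Lemma le_vol A B : row_measurable A -> row_measurable B ->
  A `<=` B -> (vol A <= vol B)%E.
Proof. by move=> mA mB AB; apply: le_measure; rewrite ?inE// => t; exact: AB. Qed.

Lemma vol_setU_le A B : row_measurable A -> row_measurable B ->
  (vol (A `|` B) <= vol A + vol B)%E.
Proof. exact: measureU2. Qed.

Lemma row_measurableI A B :
  row_measurable A -> row_measurable B -> row_measurable (A `&` B).
Proof. exact: measurableI. Qed.

Lemma row_measurableU A B :
  row_measurable A -> row_measurable B -> row_measurable (A `|` B).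
Proof. exact: measurableU. Qed.

Lemma row_measurable_cball c r : row_measurable (cball c r).
Proof.
pose f (t : n.-tuple (measurableTypeR R)) : R :=
  \sum_(i < n) (tnth t i - c 0 i) ^+ 2.
have mf : measurable_fun setT f.
  apply: measurable_sum => i; apply: measurable_funX.
  by apply: measurable_funB => //; exact: measurable_tnth.
rewrite /row_measurable; have -> : tuple_preimage (cball c r) =
    (fun t => Num.sqrt (f t)) @^-1` `]-oo, r].
  apply/seteqP; split => t; rewrite /tuple_preimage /cball /norm2 /= in_itv/=.
    by under eq_bigr do rewrite !mxE.
  by under [X in _ -> is_true (Num.sqrt X <= _)]eq_bigr do rewrite !mxE.
rewrite -[X in measurable X]setTI.
have : measurable_fun setT (fun t => Num.sqrt (f t)).
  apply: (measurableT_comp _ mf).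
  exact: continuous_measurable_fun (@sqrt_continuous R).
by apply.
Qed.

End vol.

(** * Volumes of balls, estimated by inscribed and circumscribed cubes *)

Section cube.
Context {R : realType}.

Definition cube n (a : R) : set (n.-tuple (measurableTypeR R)) :=
  [set t | forall i, `|tnth t i| <= a].

Lemma measurable_cube n (a : R) : measurable (@cube n a).
Proof.
rewrite (_ : cube a = \bigcap_(i in [set: 'I_n]) ((fun t => tnth t i) @^-1` `[-a, a])).
  apply: fin_bigcap_measurable => // i _.
  rewrite -[X in measurable X]setTI.
  by apply: (measurable_tnth i) => //; exact: measurable_itv.
apply/seteqP; split => t /= h i; have := h i; rewrite /= in_itv/= ler_norml//.
by apply.
Qed.

Lemma lebesgue_tuple_cube n (a : R) : 0 <= a ->
  lebesgue_tuple R n (cube a) = ((a *+ 2) ^+ n)%:E.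
Proof.
move=> a0; elim: n => [|n IH].
  rewrite (_ : cube a = setT) /= ?diracT//.
  by apply/seteqP; split => // t _ [].
rewrite /= /lebesgue_tuple_step /pushforward.
rewrite (_ : _ @^-1` _ = `[-a, a]%classic `*` cube a); last first.
  apply/seteqP; split => -[x t] /=.
    move=> h; split => [|i].
      by have := h ord0; rewrite in_itv/= ler_norml (tnth_nth x).
    by have := h (lift ord0 i); rewrite !(tnth_nth x).
  move=> [+ h] i; rewrite in_itv/= => xa.
  rewrite (tnth_nth x)/=; case: i => -[|i] /= ilt; first by rewrite ler_norml.
  by have := h (Ordinal (ilt : (i < n)%N)); rewrite (tnth_nth x).
rewrite product_measure1E//; last exact: measurable_cube.
rewrite IH exprS EFinM; congr (_ * _)%E.
transitivity (lebesgue_measure `[-a, a]%classic) => //.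
rewrite lebesgue_measure_itv/= lte_fin.
case: ltP => [_|aa]; first by rewrite -EFinB opprK mulr2n.
(* Degenerate interval: [a <= - a] and [0 <= a] force [a = 0], and both sides vanish. *)
by congr EFin; lra.
Qed.

(** The cube of half-side [T / n] lies in the ball. With the cube of half-side [T] around the ball,
    this replaces the exact volume of balls. *)
Lemma vol_cball_ge n (T : R) : (0 < n)%N -> 0 <= T ->
  (((T / n%:R *+ 2) ^+ n)%:E <= @vol R n (cball 0 T))%E.
Proof.
move=> n0 T0; rewrite -lebesgue_tuple_cube ?divr_ge0//.
apply: le_measure; rewrite ?inE; [exact: measurable_cube|exact: row_measurable_cball|].
move=> t /= tT; rewrite /cball /= subr0.
have -> : T = n%:R * (T / n%:R) by rewrite mulrC divfK// pnatr_eq0 -lt0n.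
by apply: norm2_le_coord => [|i]; rewrite ?divr_ge0// mxE.
Qed.

Lemma vol_cball_le n (T : R) : 0 <= T ->
  (@vol R n (cball 0 T) <= ((T *+ 2) ^+ n)%:E)%E.
Proof.
move=> T0; rewrite -lebesgue_tuple_cube//.
apply: le_measure; rewrite ?inE; [exact: row_measurable_cball|exact: measurable_cube|].
move=> t; rewrite /cball /= subr0 => tT i.
by have := le_trans (coord_le_norm2 _ i) tT; rewrite mxE.
Qed.

Lemma vol_cball_fin_num n (T : R) : 0 <= T -> @vol R n (cball 0 T) \is a fin_num.
Proof.
move=> T0; rewrite ge0_fin_numE; last exact: measure_ge0.
exact: le_lt_trans (vol_cball_le _ T0) (ltry _).
Qed.

Lemma vol_cball_unbounded n (M : R) : (0 < n)%N ->
  \forall T \near +oo, (M%:E <= @vol R n (cball 0 T))%E.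
Proof.
move=> n0; near=> T.
have T0 : 0 <= T by near: T; exact: nbhs_pinfty_ge.
apply: le_trans (vol_cball_ge n0 T0); rewrite lee_fin.
have n0' : (0 : R) < n%:R by rewrite ltr0n.
(* A base at least 1 is bounded by its [n]-th power, so it suffices that the side of the cube
   exceeds [M]. *)
have T1 : 1 <= T / n%:R *+ 2.
  apply: (@le_trans _ _ (T / n%:R)).
    rewrite ler_pdivlMr// mul1r; near: T; exact: nbhs_pinfty_ge.
  by rewrite mulr2n lerDl divr_ge0.
apply: (@le_trans _ _ (T / n%:R *+ 2)); last by rewrite ler_eXnr.
apply: (@le_trans _ _ (T / n%:R)).
  rewrite ler_pdivlMr//; near: T; exact: nbhs_pinfty_ge.
by rewrite mulr2n lerDl divr_ge0.
Unshelve. all: by end_near. Qed.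

End cube.

(** * Packings: measurability, partial densities, bounds on the density, gluing *)

Section packings.
Context {R : realType} {n : nat}.
Implicit Types (L : set 'rV[R]_n) (T e : R).

Definition covered L : set 'rV[R]_n := \bigcup_(l in L) cball l 2^-1.

Lemma translate_cball0 (l : 'rV[R]_n) T : translate l (cball 0 T) = cball l T.
Proof.
apply/seteqP; split => x; rewrite /translate /cball /=.
  by case=> a; rewrite subr0 => aT <-; rewrite addrC addKr.
by move=> xT; exists (x - l); rewrite ?subr0// addrC subrK.
Qed.

Lemma bigcup_packing L : \bigcup_(S in packing L) S = covered L.
Proof.
rewrite /packing bigcup_image /covered.
by apply: eq_bigcupr => l _; exact: translate_cball0.
Qed.

(* With N > n, two points whose coordinates have the same integer parts after
   scaling by N are at distance at most n / N < 1. *)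
Lemma UD_countable L : UD L -> countable L.
Proof.
move=> UDL; apply/countable_injP.
pose f (x : 'rV[R]_n) : {ffun 'I_n -> int} :=
  [ffun i => Num.floor (n.+1%:R * x 0 i)].
exists (pickle \o f) => x y /set_mem Lx /set_mem Ly.
move=> /(pcan_inj pickleK)/ffunP fxy; apply: contrapT => xy.
have := UDL _ _ Lx Ly xy; apply/negP; rewrite -ltNge.
have N0 : (0 : R) < n.+1%:R by rewrite ltr0n.
apply: (@le_lt_trans _ _ (n%:R * n.+1%:R^-1)); last first.
  by rewrite ltr_pdivrMr// mul1r ltr_nat.
apply: norm2_le_coord => [|i]; first by rewrite invr_ge0 ltW.
rewrite !mxE -[leRHS]div1r ler_pdivlMr// mulrC -[X in X * _](gtr0_norm N0) -normrM.
have := fxy i; rewrite !ffunE => fi.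
have /andP[x1 x2] := floor_itv (n.+1%:R * x 0 i).
have /andP[y1 y2] := floor_itv (n.+1%:R * y 0 i).
move: x1 x2; rewrite fi => x1 x2; rewrite intrD in x2 y2.
by rewrite ler_norml; apply/andP; split; lra.
Qed.

Lemma row_measurable_covered L : UD L -> row_measurable (covered L).
Proof.
move=> /UD_countable cL; rewrite /row_measurable /covered bigcup_set_type.
rewrite (_ : tuple_preimage _ =
  \bigcup_(l : L) tuple_preimage (cball (val l) 2^-1))//.
apply: countable_bigcupT_measurable => [|l]; last exact: row_measurable_cball.
by rewrite (eq_countable (card_setT _)).
Qed.

Definition partial_density L T : \bar R :=
  (vol (covered L `&` cball 0 T) / vol (cball (0 : 'rV[R]_n) T))%E.

Lemma densityE L :
  density (packing L) = limf_esup (partial_density L) (pinfty_nbhs R).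
Proof. by rewrite /density bigcup_packing. Qed.

(** The limsup is an infimum of suprema over neighbourhoods of infinity, and each neighbourhood
    contains a ray; good radii need only be arbitrarily large. *)
Lemma le_densityP L x :
  (forall M, exists2 T, M < T & (x <= partial_density L T)%E) ->
  (x <= density (packing L))%E.
Proof.
move=> h; rewrite densityE limf_esupE; apply: le_ereal_inf_tmp => _ [A [M [_ MA]] <-].
have [T MT xT] := h M.
by apply: le_ereal_sup_tmp; exists (partial_density L T) => //; exists T => //; exact: MA.
Qed.

(** The limsup is at most the supremum over the ray beyond [M]. *)
Lemma lt_density L x M : (x < density (packing L))%E ->
  exists2 T, M < T & (x < partial_density L T)%E.
Proof.
rewrite densityE limf_esupE => xL.
have /ereal_sup_gt[_ [T MT <-] xT] :
    (x < ereal_sup (partial_density L @` [set T | (M < T)%R]))%E.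
  apply: (lt_le_trans xL); apply: ereal_inf_lbound.
  by exists [set T | (M < T)%R] => //; exists M; split => //; exact: num_real.
by exists T.
Qed.

Lemma partial_density_ge0 L T : (0 <= partial_density L T)%E.
Proof. by rewrite mule_ge0 ?inve_ge0 ?measure_ge0. Qed.

Lemma row_measurable_covered_cball L T :
  UD L -> row_measurable (covered L `&` cball 0 T).
Proof.
move=> UDL; apply: row_measurableI; last exact: row_measurable_cball.
exact: row_measurable_covered.
Qed.

Lemma density_ge0 L : (0 <= density (packing L))%E.
Proof.
apply: le_densityP => M; exists (M + 1); first by rewrite ltrDl.
exact: partial_density_ge0.
Qed.

Context (n_gt0 : (0 < n)%N).

Lemma vol_cball_gt0 T : 0 < T -> (0 < @vol R n (cball 0 T))%E.
Proof.
move=> T0; apply: lt_le_trans (vol_cball_ge n_gt0 (ltW T0)).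
by rewrite lte_fin exprn_gt0// pmulrn_lgt0// divr_gt0// ltr0n.
Qed.

(** Turns division by the volume of a ball in the extended reals into division by a positive real,
    so that denominators can be cleared. *)
Lemma vol_cballV T : 0 < T ->
  exists2 v : R, 0 < v & @vol R n (cball 0 T) = v%:E /\
    (@vol R n (cball 0 T))^-1%E = v^-1%:E.
Proof.
move=> T0; exists (fine (@vol R n (cball 0 T))).
  by rewrite fine_gt0// vol_cball_gt0//= -ge0_fin_numE ?measure_ge0// vol_cball_fin_num// ltW.
have := vol_cball_gt0 T0; rewrite -(fineK (vol_cball_fin_num n (ltW T0)))/= => v0.
by split => //; rewrite inver gt_eqF.
Qed.

Lemma partial_density_le1 L T : UD L -> 0 < T -> (partial_density L T <= 1)%E.
Proof.
move=> UDL T0; have [v v0 [vE vVE]] := vol_cballV T0.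
rewrite /partial_density vVE lee_pdivrMr// mul1e -vE.
apply: le_vol; [exact: row_measurable_covered_cball|exact: row_measurable_cball|].
by move=> ? [].
Qed.

Lemma density_le1 L : UD L -> (density (packing L) <= 1)%E.
Proof.
move=> UDL; rewrite leNgt; apply/negP => /lt_density -/(_ 0)[T T0].
by rewrite ltNge partial_density_le1.
Qed.

(** The constant lies between 0, by the empty packing, and 1. Finiteness is what allows
    approximating the supremum within [e]. *)
Lemma packing_constant_fin_num : packing_constant R n \is a fin_num.
Proof.
rewrite fin_real//; apply/andP; split.
  apply: (@lt_le_trans _ _ 0%E); first exact: ltNyr.
  apply: le_ereal_sup_tmp; exists (density (packing (set0 : set 'rV[R]_n))).
    by exists set0.
  exact: density_ge0.
apply: (@le_lt_trans _ _ 1%E); last exact: ltry.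
by apply: ge_ereal_sup => _ [L UDL <-]; exact: density_le1.
Qed.

(* A ball of [L1] meeting [cball 0 T] has its center in [cball 0 (T + 1/2)];
   either the ball is in [packing L2] or it is contained in
   [cball 0 (s + 1/2)]. *)
Lemma partial_density_le_annulus L1 L2 s T : UD L1 -> UD L2 -> 0 < T ->
  (forall l, L1 l -> s <= norm2 l <= T + 2^-1 -> L2 l) ->
  (partial_density L1 T <= partial_density L2 T +
    vol (cball (0 : 'rV[R]_n) (s + 2^-1)) / vol (cball (0 : 'rV[R]_n) T))%E.
Proof.
move=> UD1 UD2 T0 L12; rewrite /partial_density.
have [v v0 [_ ->]] := vol_cballV T0.
rewrite -ge0_muleDl ?measure_ge0//; apply: lee_wpmul2r.
  by rewrite lee_fin invr_ge0 ltW.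
have mb r : row_measurable (cball (0 : 'rV[R]_n) r) by exact: row_measurable_cball.
have mc := row_measurable_covered_cball.
apply: le_trans (vol_setU_le (mc _ T UD2) (mb _)).
apply: le_vol; [exact: mc|apply: row_measurableU => //; exact: mc|].
move=> z [[l L1l zl] zT]; move: (zl) (zT); rewrite /cball/= subr0 => zl' zT'.
have lT : norm2 l <= T + 2^-1.
  by rewrite -(subrK z l) (le_trans (ler_norm2D _ _))// addrC lerD// norm2_distC.
have [sl|ls] := leP s (norm2 l).
  by left; split => //; exists l => //; apply: L12 => //; rewrite sl.
right; rewrite /cball /= -(subrK l z) (le_trans (ler_norm2D _ _))//.
by rewrite addrC lerD// ltW.
Qed.

(** One stage of the construction: given the inner radius [s], it provides the next packing and its
    outer radius. *)
Lemma near_packing_constant e s : 0 < e -> 0 <= s ->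
  exists (L : set 'rV[R]_n) T, [/\ UD L, s < T,
    (packing_constant R n - e%:E < partial_density L T)%E &
    (vol (cball (0 : 'rV[R]_n) (s + 2^-1)) / vol (cball (0 : 'rV[R]_n) T)
       <= e%:E)%E].
Proof.
move=> e0 s0.
have [_ [L UDL <-] eL] := ub_ereal_sup_adherent e0 packing_constant_fin_num.
have s20 : 0 <= s + 2^-1 by rewrite addr_ge0.
set w := vol (cball (0 : 'rV[R]_n) (s + 2^-1)).
have wE : w = (fine w)%:E by rewrite fineK// vol_cball_fin_num.
(* Beyond [M] the ball has volume at least [w / e], so the inner ball takes up a proportion at most
   [e]. *)
have [M [_ MT]] := @vol_cball_unbounded R n (fine w / e) n_gt0.
have [T + LT] := lt_density (Num.max M s) eL.
rewrite gt_max => /andP[/MT vT sT].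
exists L, T; split => //.
have [v v0 [vE ->]] := vol_cballV (le_lt_trans s0 sT).
rewrite lee_pdivrMr// wE -EFinM lee_fin mulrC -ler_pdivrMr//.
by rewrite -lee_fin -vE.
Qed.

(* [S k.+1 >= T k + 3/2] keeps the annuli at distance at least 1. *)
Lemma UD_glue (L : nat -> set 'rV[R]_n) (S T : nat -> R) :
  (forall k, UD (L k)) -> (forall j k, (j < k)%N -> T j + 3 / 2 <= S k) ->
  UD [set x | exists2 k, L k x & S k <= norm2 x <= T k + 2^-1].
Proof.
move=> UDL TS.
have far (x y : 'rV[R]_n) j k : (j < k)%N -> norm2 x <= T j + 2^-1 -> S k <= norm2 y ->
    1 <= norm2 (y - x).
  move=> /TS jk xT Sy; have := ler_norm2B y x.
  by apply: le_trans; lra.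
move=> x y [j Lx /andP[Sx xT]] [k Ly /andP[Sy yT]] xy.
have [jk|kj|jk] := ltngtP j k; first by rewrite norm2_distC (far x y j k).
  by rewrite (far y x k j).
by apply: (UDL j) => //; rewrite jk.
Qed.

End packings.

(** * Choice of the annuli and optimality of the glued set *)

Theorem theorem2p4 (R : realType) (n : nat) (hn : (1 <= n)%N) :
  exists2 L : set 'rV[R]_n, UD L & density (packing L) = packing_constant R n.
Proof.
pose eps k : R := k.+1%:R^-1.
have eps_gt0 k : 0 < eps k by rewrite invr_gt0 ltr0n.
have /choice[f fP] (p : nat * R) : exists q : set 'rV[R]_n * R, 0 <= p.2 ->
    [/\ UD q.1, p.2 < q.2,
      (packing_constant R n - (eps p.1)%:E < partial_density q.1 q.2)%E &
      (vol (cball (0 : 'rV[R]_n) (p.2 + 2^-1)) /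
         vol (cball (0 : 'rV[R]_n) q.2) <= (eps p.1)%:E)%E].
  (* Choice needs a value for every pair; for a negative radius the pair [(set0, 0)] is a dummy. *)
  have [p0|p0] := leP 0 p.2; last by exists (set0, 0).
  have [L [T LT]] := near_packing_constant hn (eps_gt0 p.1) p0.
  by exists (L, T).
(* Inner radii: centers of stage [k'] reach norm [T k' + 1/2], and a further gap of 1 gives
   [3 / 2]. *)
pose S := fix S k : R := if k is k'.+1 then (f (k', S k')).2 + 3 / 2 else 0.
pose L k := (f (k, S k)).1; pose T k := (f (k, S k)).2.
have S_ge0 k : 0 <= S k.
  elim: k => //= k IH; have [_ + _ _] := fP (k, S k) IH.
  by move=> /= /ltW /(le_trans IH) ?; rewrite addr_ge0.
have LT k := fP (k, S k) (S_ge0 k).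
have ST k : S k < T k by have [] := LT k.
have SS k : S k.+1 = T k + 3 / 2 by [].
have S_nd : nondecreasing_seq S.
  by apply/nondecreasing_seqP => k; rewrite SS; have := ST k; lra.
have TS j k : (j < k)%N -> T j + 3 / 2 <= S k by rewrite -SS; exact: S_nd.
(* The radii tend to infinity, each stage adding more than 1. *)
have S_ge k : k%:R <= S k.
  elim: k => // k IH; rewrite SS -natr1; have := ST k; lra.
have UDL k : UD (L k) by have [] := LT k.
have UDG := UD_glue UDL TS.
exists [set x | exists2 k, L k x & S k <= norm2 x <= T k + 2^-1] => //.
set G := (X in packing X) in UDG *.
apply/eqP; rewrite eq_le; apply/andP; split.
  by apply: ereal_sup_ubound; exists G.
apply/lee_addgt0Pr => e e0; rewrite -leeBlDr//.
apply: le_densityP => M.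
(* The first term makes [T k] exceed [M]; the second makes [2 * eps k] at most [e]. *)
pose k := maxn (Num.truncn M).+1 (Num.truncn (2 / e)).+1.
have Mk : M < k%:R.
  by apply: (lt_le_trans (truncnS_gt M)); rewrite ler_nat leq_maxl.
have ek : eps k *+ 2 <= e.
  have : 2 / e < k%:R.
    by apply: (lt_le_trans (truncnS_gt _)); rewrite ler_nat leq_maxr.
  rewrite ltr_pdivrMr// => ke.
  rewrite /eps -[leLHS]mulr_natl ler_pdivrMr ?ltr0n// mulrC -(natr1 k).
  by rewrite (le_trans (ltW ke))// ler_wpM2r ?(ltW e0)// lerDl.
have [_ _ pk vk] := LT k.
have Tk0 : 0 < T k by exact: le_lt_trans (S_ge0 k) (ST k).
exists (T k); first by rewrite (lt_trans Mk)// (le_lt_trans (S_ge k)).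
(* Two losses of [eps k]: one from the near-optimality of [L k] at radius [T k], one from discarding
   its points of norm less than [S k]. *)
have LG : (packing_constant R n - (eps k)%:E <=
    partial_density G (T k) + (eps k)%:E)%E.
  apply: (le_trans (ltW pk)).
  apply: le_trans (leeD2l _ vk).
  apply: (partial_density_le_annulus hn (UDL k) UDG Tk0) => l Lkl lk.
  by exists k.
apply: (@le_trans _ _ (packing_constant R n - (eps k *+ 2)%:E)%E).
  by rewrite leeD2l// leeN2 lee_fin.
by move: LG; rewrite -leeBlDr// mulr2n EFinD oppeD// addeA.
Qed.
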